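(* Let $n \ge 1$ be an integer and let $\mathbb{R}^n$ be endowed with a closed cone $C$. Let $T : \mathbb{R}^n \to \mathbb{R}^n$ be a positive linear map (with respect to $C$) with spectrum $\sigma(T) = \{1\}$ and such that all Jordan blocks of $T$ have size $\le 2$. Then $T \ge \operatorname{id}$, i.e. $Tv - v \in C$ for every $v \in C$.
   Context: A cone in a real vector space $V$ is a subset $V_+ \subseteq V$ such that $\alpha V_+ + \beta V_+ \subseteq V_+$ for all scalars $\alpha,\beta \in [0,\infty)$ and $V_+ \cap (-V_+) = \{0\}$. It induces a partial order on $V$ by $v \le w$ if and only if $w - v \in V_+$. A linear map $T : V \to V$ is called positive (written $T \ge 0$) if $T V_+ \subseteq V_+$; for linear maps $S,T : V \to V$ one writes $S \le T$ if $T - S$ is positive. Here $V = \mathbb{R}^n$, $V_+ = C$, closedness is with respect to the usual topology of $\mathbb{R}^n$, $\operatorname{id}$ is the identity map, and $\sigma(T)$ is the set of complex eigenvalues of $T$. *)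

(* Defs.v *)
From HB Require Import structures.
From mathcomp Require Import all_boot all_order all_algebra.
From mathcomp Require Import complex.
From mathcomp Require Import all_classical all_reals.
From mathcomp Require Import topology normedtype.

Set Implicit Arguments.
Unset Strict Implicit.
Unset Printing Implicit Defensive.

Import GRing.Theory Num.Theory.
Import numFieldNormedType.Exports.

Local Open Scope classical_set_scope.
Local Open Scope ring_scope.

Definition cone (R : realType) (V : lmodType R) (C : set V) : Prop :=
  (forall a b : R, 0 <= a -> 0 <= b ->
     forall v w : V, C v -> C w -> C (a *: v + b *: w)) /\
  C `&` [set - v | v in C] = [set 0].

Definition positive_map (R : realType) (V : lmodType R) (C : set V)
  (T : {linear V -> V}) : Prop := T @` C `<=` C.

Definition le_map (R : realType) (V : lmodType R) (C : set V)
  (S T : {linear V -> V}) : Prop := positive_map C (T \- S).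

(* The complexified matrix of T in the standard basis.  Following the
   row-vector convention of lin1_mx, [T v = v *m lin1_mx T], so the (left)
   eigenvectors of this matrix are those of the complexification of T. *)
Definition complex_mx (R : realType) (n : nat)
  (T : {linear 'rV[R]_n -> 'rV[R]_n}) : 'M[R[i]]_n :=
  map_mx (real_complex R) (lin1_mx T).

Definition spectrum (R : realType) (n : nat)
  (T : {linear 'rV[R]_n -> 'rV[R]_n}) : set R[i] :=
  [set z | eigenvalue (complex_mx T) z].

Definition jordan_block (F : fieldType) (m : nat) (z : F) : 'M[F]_m :=
  \matrix_(i, j) (z *+ (i == j) + (i.+1 == j :> nat)%:R).

(* The block-diagonal matrix with the k nonempty blocks
   [jordan_block (p i) (z i)] is a Jordan normal form of A. *)
Definition jordan_form_of (F : fieldType) (n : nat) (A : 'M[F]_n)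
  (k : nat) (p : 'I_k -> nat) (z : 'I_k -> F) : Prop :=
  (forall i, 0 < p i)%N /\
  exists e : (\sum_i p i)%N = n,
    similar_in unitmx A
      (castmx (e, e) (\mxdiag_i jordan_block (p i) (z i))).

(* A Jordan normal form exists over R[i] and is unique up to the order of its
   blocks, so "all Jordan blocks of T have size at most m" may be read off
   any one of them. *)
Definition jordan_blocks_size_le (R : realType) (n : nat)
  (T : {linear 'rV[R]_n -> 'rV[R]_n}) (m : nat) : Prop :=
  exists (k : nat) (p : 'I_k -> nat) (z : 'I_k -> R[i]),
    jordan_form_of (complex_mx T) p z /\ (forall i, p i <= m)%N.

(* Main.v *)
Require Import Defs.
From mathcomp Require Import all_boot all_order all_algebra.
From mathcomp Require Import complex.
From mathcomp Require Import all_classical all_reals.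
From mathcomp Require Import topology normedtype.
From mathcomp Require Import sequences.

Set Implicit Arguments.
Unset Strict Implicit.
Unset Printing Implicit Defensive.

Import GRing.Theory Num.Theory.
Import numFieldNormedType.Exports.

Local Open Scope classical_set_scope.
Local Open Scope ring_scope.

(** Write [N = T - id].  All eigenvalues being 1 and all Jordan blocks having
    size at most 2, [N] squares to zero, so the powers of [T] grow linearly:
    [T^k = id + k N].  For [v] in the cone, [T^k v / k = v / k + N v] lies in
    the cone for every [k > 0] and tends to [N v], which is therefore in the
    closed cone; that is [T v - v >= 0].

    The identity [N^2 = 0] is obtained blockwise over [R[i]]
    ([jordan_form_sub_scalar_sqr]), once the scalars of the blocks are known
    to be eigenvalues ([jordan_form_eigenvalue]), and then pulled back to [R]
    by injectivity of the embedding.  The limit argument is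
    [positive_sub_id_sqr0], which holds in any normed module. *)

Section JordanForm.
Variable F : fieldType.

(** The nilpotent part of a Jordan block shifts the standard basis by one, so
    its square shifts by two, which leaves a block of size at most 2. *)
Lemma jordan_block_sub_scalar_sqr (m : nat) (a : F) : (m <= 2)%N ->
  (jordan_block m a - a%:M) *m (jordan_block m a - a%:M) = 0.
Proof.
move=> m2.
have shift i j :
    (jordan_block m a - a%:M) i j = (i.+1 == j :> nat)%:R.
  by rewrite !mxE addrC addKr.
apply/matrixP => i k; rewrite !mxE big1// => j _.
rewrite !shift -natrM mulnb; case: andP => // -[/eqP ij /eqP jk].
by have := leq_trans (ltn_ord k) m2; rewrite -jk -ij !ltnS ltn0.
Qed.

(** Since vectors are rows, the eigenvector of a Jordan block is its last basis
    vector: no superdiagonal entry lies in the last row. *)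
Lemma jordan_block_eigenvalue (m : nat) (a : F) : (0 < m)%N ->
  eigenvalue (jordan_block m a) a.
Proof.
case: m => // m _; apply/eigenvalueP; exists (delta_mx 0 ord_max).
  rewrite -rowE; apply/rowP => j; rewrite !mxE eq_sym mulr_natr eqxx /=.
  by rewrite [m.+1 == j]gtn_eqF// addr0.
by apply/rV0Pn; exists ord_max; rewrite mxE !eqxx oner_neq0.
Qed.

(** An eigenvector of one diagonal block, padded with zeros. *)
Lemma mxdiag_eigenvalue (k : nat) (p : 'I_k -> nat)
    (B : forall i, 'M[F]_(p i)) (i : 'I_k) (a : F) :
  eigenvalue (B i) a -> eigenvalue (\mxdiag_j B j) a.
Proof.
move=> /eigenvalueP[v vB v0].
pose w (j : 'I_k) : 'rV[F]_(p j) := if i == j then conform_mx 0 v else 0.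
have wi : w i = v by rewrite /w eqxx conform_mx_id.
apply/eigenvalueP; exists (\mxrow_j w j).
  rewrite mul_mxrow_mxdiag -mul_scalar_mx mul_mxrow; apply: eq_mxrow => j.
  rewrite mul_scalar_mx; have [<-|ij] := eqVneq i j; first by rewrite wi.
  by rewrite /w (negbTE ij) mul0mx scaler0.
apply: contra_neq v0 => w0; rewrite -wi -(mxrowK w i) w0.
exact: submxrow0.
Qed.

Variables (n : nat) (A : 'M[F]_n) (k : nat) (p : 'I_k -> nat) (z : 'I_k -> F).
Hypothesis AJ : jordan_form_of A p z.

Lemma jordan_form_eigenvalue (i : 'I_k) : eigenvalue A (z i).
Proof.
have [p0 [e [P Pu /eqP AB]]] := AJ.
apply: (@eigenvalue_conjmx _ _ _ P); rewrite ?stablemx_unit ?row_free_unit//.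
rewrite AB; case: _ / e {P Pu AB}; rewrite castmx_id.
exact/mxdiag_eigenvalue/jordan_block_eigenvalue.
Qed.

Lemma jordan_form_sub_scalar_sqr (a : F) :
  (forall i, p i <= 2)%N -> (forall i, z i = a) ->
  (A - a%:M) *m (A - a%:M) = 0.
Proof.
have [_ [e [P Pu /(simmxP Pu) AB]]] := AJ; move=> p2 za.
set D := castmx _ _ in AB.
have D0 : (D - a%:M) *m (D - a%:M) = 0.
  rewrite /D; case: _ / e {P Pu AB D}; rewrite castmx_id -mxdiagZ -mxdiagB.
  rewrite {2}/mxdiag mul_mxdiag_mxblock -[RHS]mxblock0.
  apply: eq_mxblock => i j; case: eqVneq => [<-|_]; last by rewrite mulmx0.
  by rewrite conform_mx_id za jordan_block_sub_scalar_sqr.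
have PA : P *m (A - a%:M) = (D - a%:M) *m P.
  by rewrite mulmxBr mulmxBl AB scalar_mxC.
apply: (can_inj (mulKmx Pu)).
by rewrite mulmxA PA -mulmxA PA mulmxA D0 mul0mx mulmx0.
Qed.

End JordanForm.

(** The vector [T v - v] is the limit of [T^k v / k], since
    [T^k v = v + k (T v - v)]; the condition [(T - id)^2 = 0] is written in the
    form that the induction on [k] uses. *)
Lemma positive_sub_id_sqr0 (R : realType) (V : normedModType R) (C : set V)
    (T : {linear V -> V}) :
  cone C -> closed C -> positive_map C T ->
  (forall v, T (T v - v) = T v - v) -> le_map C idfun T.
Proof.
move=> [Ccomb _] Cclosed Tpos TN _ [v Cv <-] /=.
have iterT m : iter m T v = v + m%:R *: (T v - v).
  elim: m => [|m IHm]; first by rewrite scale0r addr0.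
  rewrite iterS IHm linearD linearZ /= TN -natr1 scalerDl scale1r.
  by rewrite [_ + (T v - v)]addrC addrA [v + _]addrC subrK.
have Citer m : C (iter m T v).
  by elim: m => //= m IHm; apply: Tpos; exists (iter m T v).
apply: (closed_cvg C Cclosed (u_ := fun m => harmonic m *: v + (T v - v))
         (F := \oo)).
  apply: nearW => m.
  have m0 : m.+1%:R != 0 :> R by rewrite pnatr_eq0.
  have := Ccomb _ 0 (harmonic_ge0 m) (Order.POrderTheory.lexx 0) _ _ (Citer m.+1) (Citer 0).
  by rewrite scale0r addr0 iterT scalerDr scalerA mulVf// scale1r.
have := cvgD (cvgZr_tmp (a := v) (@cvg_harmonic R)) (cvg_cst (T v - v)).
by rewrite scale0r add0r; apply.
Qed.

Theorem corollary3p2 (R : realType) (n : nat) (hn : (1 <= n)%N)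
  (C : set 'rV[R]_n) (Ccone : cone C) (Cclosed : closed C)
  (T : {linear 'rV[R]_n -> 'rV[R]_n}) (Tpos : positive_map C T)
  (Tspec : spectrum T = [set 1]) (Tjordan : jordan_blocks_size_le T 2) :
  le_map C idfun T.
Proof.
have [k [p [z [TJ p2]]]] := Tjordan.
have z1 i : z i = 1.
  have : spectrum T (z i) := jordan_form_eigenvalue TJ i.
  by rewrite Tspec.
have := jordan_form_sub_scalar_sqr TJ p2 z1.
rewrite /complex_mx -(map_scalar_mx (real_complex R)) -map_mxB -map_mxM.
rewrite -(map_mx0 (real_complex R)) => /map_mx_inj M0.
apply: positive_sub_id_sqr0 => // v.
apply/eqP; rewrite -subr_eq0; apply/eqP.
have NE w : T w - w = w *m (lin1_mx T - 1%:M).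
  by rewrite mulmxBr mulmx1 mul_rV_lin1.
by rewrite !NE -mulmxA M0 mulmx0.
Qed.
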